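(* Let $X$ be a sieve-complete space and $Y$ a $\mu$-space. If there exists a monotone set tri-quotient map $F\colon\mathcal{K}(X)\to 2^Y$ such that each $F(K)$, $K\in\mathcal{K}(X)$, has compact closure in $Y$, then $Y$ is sieve-complete and $l(Y)\leq l(X)$.
   Context: All spaces are completely regular. $\mathcal{K}(X)$ is the set of compact subsets of $X$; $\mathcal{T}(X)$ the topology. $F\colon\mathcal{K}(X)\to 2^Y$ is monotone if $K\subset L$ implies $F(K)\subset F(L)$; it is set tri-quotient if there is $s\colon\mathcal{T}(X)\to\mathcal{T}(Y)$ with: (str1) $s(U)\subset\bigcup\{F(K):K\in\mathcal{K}(X),K\subset U\}$; (str2) $s(X)=Y$; (str3) $U\subset V\Rightarrow s(U)\subset s(V)$; (str4) if $y\in s(U)$ and $\mathcal{W}$ is a cover of $\bigcup\{K\in F^{-1}(y):K\subset U\}$ by open subsets of $X$, then $y\in s(\bigcup\mathcal{E})$ for some finite $\mathcal{E}\subset\mathcal{W}$, where $F^{-1}(y)=\{K\in\mathcal{K}(X):y\in F(K)\}$. A $\mu$-space is one in which every closed bounded set is compact ($A$ bounded: every continuous real function is bounded on $A$). A sieve on $X$ is a sequence of open covers $\{U_\alpha:\alpha\in A_n\}_{n\in\mathbb{N}}$ with maps $\pi_n\colon A_{n+1}\to A_n$ such that $U_\alpha=\bigcup\{U_\beta:\beta\in\pi_n^{-1}(\alpha)\}$; it is complete if for every sequence $(\alpha_n)$ with $\alpha_n\in A_n$, $\pi_n(\alpha_{n+1})=\alpha_n$, every filter base meshing with $\{U_{\alpha_n}\}$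 (each member meets each $U_{\alpha_n}$) has a cluster point; a space with a complete sieve is sieve-complete. $l(\cdot)$ is the Lindelöf number. *)

(* Defs.v *)
From HB Require Import structures.
From mathcomp Require Import all_boot all_order all_algebra.
From mathcomp Require Import all_classical all_reals all_analysis.
Set Implicit Arguments. Unset Strict Implicit. Unset Printing Implicit Defensive.
Import Order.TTheory GRing.Theory Num.Theory.
Import numFieldNormedType.Exports.
Local Open Scope classical_set_scope.
Local Open Scope ring_scope.

Definition tychonoff_space (R : realType) (X : topologicalType) : Prop :=
  (forall x y : X, x <> y -> exists U : set X, open U /\ U x /\ ~ U y) /\
  (forall (A : set X) (x : X), closed A -> ~ A x ->
     exists f : X -> R, continuous f /\ f x = 0 /\ (forall a, A a -> f a = 1)).

Definition fbounded (R : realType) (X : topologicalType) (A : set X) : Prop :=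
  forall f : X -> R, continuous f -> exists M : R, forall a, A a -> `|f a| <= M.

Definition mu_space (R : realType) (X : topologicalType) : Prop :=
  forall A : set X, closed A -> fbounded R A -> compact A.

Definition is_sieve (X : topologicalType) (Idx : nat -> Type)
    (U : forall n, Idx n -> set X) (pi : forall n, Idx n.+1 -> Idx n) : Prop :=
  (forall n (a : Idx n), open (U n a)) /\
  (forall n, \bigcup_(a in [set: Idx n]) U n a = setT) /\
  (forall n (a : Idx n), U n a = \bigcup_(b in [set b | pi n b = a]) U n.+1 b).

Definition filter_base (X : Type) (B : set (set X)) : Prop :=
  B !=set0 /\
  (forall B1 B2, B B1 -> B B2 -> exists2 B3, B B3 & B3 `<=` B1 `&` B2).

Definition complete_sieve (X : topologicalType) (Idx : nat -> Type)
    (U : forall n, Idx n -> set X) (pi : forall n, Idx n.+1 -> Idx n) : Prop :=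
  is_sieve U pi /\
  forall alpha : forall n, Idx n, (forall n, pi n (alpha n.+1) = alpha n) ->
  forall B : set (set X), filter_base B ->
    (forall Bm n, B Bm -> Bm `&` U n (alpha n) !=set0) ->
    exists x : X, forall Bm, B Bm -> closure Bm x.

Definition sieve_complete (X : topologicalType) : Prop :=
  exists (Idx : nat -> Type) (U : forall n, Idx n -> set X)
         (pi : forall n, Idx n.+1 -> Idx n), complete_sieve U pi.

(* F : K(X) -> 2^Y, represented as a map on all subsets, only used on compacts *)
Definition monotone_on_compacts (X Y : topologicalType) (F : set X -> set Y) :=
  forall K L : set X, compact K -> compact L -> K `<=` L -> F K `<=` F L.

(* set tri-quotient; s : T(X) -> T(Y) represented as a map on all subsets
   sending open sets to open sets, only used on open sets *)
Definition set_tri_quotient (X Y : topologicalType) (F : set X -> set Y) :=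
  exists s : set X -> set Y,
    (forall U, open U -> open (s U)) /\
    (forall U, open U ->
       s U `<=` \bigcup_(K in [set K | compact K /\ K `<=` U]) F K) /\
    s setT = setT /\
    (forall U V, open U -> open V -> U `<=` V -> s U `<=` s V) /\
    (forall U (y : Y) (W : set (set X)), open U -> s U y ->
       (forall w, W w -> open w) ->
       \bigcup_(K in [set K | compact K /\ K `<=` U /\ F K y]) K
         `<=` \bigcup_(w in W) w ->
       exists2 E : set (set X), finite_set E /\ E `<=` W &
         s (\bigcup_(e in E) e) y).

(* "l(X) <= |I|" for an (infinite) index type I: every open cover of X has a
   subcover of cardinality at most |I|. *)
Definition lindelof_le (X : topologicalType) (I : Type) : Prop :=
  forall C : set (set X), (forall c, C c -> open c) ->
    \bigcup_(c in C) c = setT ->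
    exists2 D : set (set X), D `<=` C /\ \bigcup_(d in D) d = setT &
      (D #<= [set: I])%card.

(* Main.v *)
(* Refining a complete sieve of X along closures and along the Lindelof number
   gives a complete sieve indexed by the finite sequences over an index set I
   with l(X) <= |I|.  Passing to finite unions of its nodes, condition (str4)
   makes the sets s(U_E), E a finite set of nodes, a sieve on Y.  It is complete:
   a decreasing complete sequence (U_n) of X absorbs any sequence of compacts
   K_n in U_n into one compact L, so a sequence y_n in s(U_n) stays in F(L), which
   has compact closure; hence the intersection of the closures of the s(U_n) is
   bounded, thus compact since Y is a mu-space, and attracts the filters meshing
   with (s(U_n)).  Finally, given an open cover of Y, by completeness the nodes
   lying in a finite union of members of the cover already cover Y, and there
   are at most |I| nodes because |I * I| = |I| for infinite I. *)
Require Import Defs.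
From HB Require Import structures.
From mathcomp Require Import all_boot all_order all_algebra.
From mathcomp Require Import all_classical all_reals all_analysis.
From Stdlib Require Import Eqdep_dec PeanoNat.
Import Order.TTheory GRing.Theory Num.Theory.
Import numFieldNormedType.Exports.
Local Open Scope classical_set_scope.

(** * Compactness and complete sequences *)

Lemma tychonoff_regular {R : realType} {X : topologicalType} :
  tychonoff_space R X -> regular_space X.
Proof.
move=> [_ sepX] x; apply/regular_openP => A clA nAx.
have [f [cf [fx0 fA1]]] := sepX A x clA nAx.
exists (f @^-1` [set r | (r < 2^-1)%R]), (f @^-1` [set r | (2^-1 < r)%R]); split.
- by move: cf => /continuousP; apply; exact: open_lt.
- by move: cf => /continuousP; apply; exact: open_gt.
- by rewrite /= fx0 invr_gt0.
- by move=> a /fA1 /= ->; rewrite invf_lt1// ltr1n.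
- by rewrite -subset0 => y [/= /lt_trans h /h]; rewrite ltxx.
Qed.

(** Completeness along one thread of a sieve, in terms of filters: for decreasing [W], a filter base
    meshing with all [W n] generates together with them such a filter [G]. *)
Definition complete_seq {X : topologicalType} (W : nat -> set X) :=
  forall G : set_system X, ProperFilter G -> (forall n, G (W n)) ->
  cluster G !=set0.

Lemma complete_seq_ultra {X : topologicalType} (W : nat -> set X) :
  (forall G : set_system X, UltraFilter G -> (forall n, G (W n)) ->
     cluster G !=set0) ->
  complete_seq W.
Proof.
move=> ultraW G PG GW; have [U [UU GU]] := ultraFilterLemma PG.
have [|x Ux] := ultraW U UU; first by move=> n; exact/GU/GW.
by exists x; exact: cvg_cluster Ux.
Qed.

(* In a regular space it suffices to look at the filters containing [D] itself:
   a filter [G] on [closure D] is traced on [D] through its open members. *)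
Lemma compact_closure_ultra {X : topologicalType} (D : set X) :
  regular_space X ->
  (forall G : set_system X, UltraFilter G -> G D -> cluster G !=set0) ->
  compact (closure D).
Proof.
move=> regX cD G PG GC.
pose H := filter_from [set V : set X | open V /\ G V] (fun V => V `&` D).
have PH : ProperFilter H.
  apply: filter_from_proper.
    apply: filter_from_filter.
      by exists setT; split; [exact: openT|exact: filterT].
    move=> V1 V2 [oV1 GV1] [oV2 GV2]; exists (V1 `&` V2).
      by split; [exact: openI|exact: filterI].
    by move=> x [[V1x V2x] Dx].
  move=> V [oV GV]; have [x [Vx Cx]] := filter_ex (filterI GV GC).
  have [y [Dy Vy]] := Cx V (open_nbhs_nbhs (conj oV Vx)).
  by exists y.
have HD : H D.
  exists setT; first by split; [exact: openT|exact: filterT].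
  by move=> x [].
have [U [UU HU]] := ultraFilterLemma PH.
have [p /(cvg_cluster HU) Hp] := cD U UU (HU _ HD).
exists p; split; first by move=> A nA; exact: Hp HD nA.
(* If [B] missed [N], it would lie in the open complement of [closure V], which then belongs to [H]
   but misses the neighbourhood [V] of [p]. *)
move=> B N GB nN; apply: contrapT => BN0.
have [V nV clVN] := regX p N nN.
have HV : H (~` closure V).
  exists (~` closure V); last by move=> x [].
  split; first exact/closed_openC/closed_closure.
  apply: filterS GB => x Bx clVx; apply: BN0; exists x; split=> //.
  exact: clVN.
have [x [nclVx Vx]] := Hp _ _ HV nV.
by apply: nclVx; exact: subset_closure.
Qed.

(** An ultrafilter containing the union [D] either contains some compact [K n] or avoids them all.
    In the second case it contains every [W n], because what is left of [D] after removing the first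
    [n] compacts lies in [W n]. *)
Lemma compact_seq_union {X : topologicalType} (W K : nat -> set X) :
  regular_space X -> (forall m n, (m <= n)%N -> W n `<=` W m) ->
  complete_seq W -> (forall n, compact (K n)) -> (forall n, K n `<=` W n) ->
  exists2 L : set X, compact L & forall n, K n `<=` L.
Proof.
move=> regX decW cW cK KW; pose D := \bigcup_n K n.
exists (closure D); last first.
  by move=> n x Kx; apply: subset_closure; exists n.
apply: compact_closure_ultra => // G UG GD.
have [[n GK]|nGK] := pselect (exists n, G (K n)).
  by have [x [_ Gx]] := cK n G _ GK; exists x.
apply: cW => n.
have : G (D `&` \bigcap_(i < n) ~` K i).
  apply: filterI => //; elim: n => [|n IHn].
    by apply: filterS (filterT : G setT) => x _ i.
  have GKn : G (~` K n).
    by have [GK|//] := in_ultra_setVsetC (K n) UG; case: nGK; exists n.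
  apply: filterS (filterI IHn GKn) => x [Kx Knx] i /=.
  by rewrite ltnS leq_eqVlt => /predU1P[->//|]; exact: Kx.
apply: filterS => x [[m _ Kx] nK].
have nm : (n <= m)%N by rewrite leqNgt; apply/negP => /nK.
by apply: (decW _ _ nm); exact: KW.
Qed.

(** * Squares of infinite sets *)

(** Zorn's lemma on graphs of partial injections: a maximal graph is defined on all of [A] or
    reaches all of [B], since otherwise a pair of missed points could be added. *)
Lemma embedding_total {T : Type} (A B : set T) (a0 b0 : T) : A a0 -> B b0 ->
  (exists2 g : T -> T, set_fun A B g & set_inj A g) \/
  (exists2 g : T -> T, set_fun B A g & set_inj B g).
Proof.
move=> Aa0 Bb0.
pose P (H : set (T * T)) := [/\ forall a b, H (a, b) -> A a /\ B b,
  forall a b b', H (a, b) -> H (a, b') -> b = b' &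
  forall a a' b, H (a, b) -> H (a', b) -> a = a'].
have [FF FFP FFtot|H [[HAB Hf Hi] maxH]] := @Zorn_bigcup (T * T)%type P.
  split.
  - by move=> a b [G /FFP[GAB _ _]]; exact: GAB.
  - move=> a b b' [G FG Gb] [G' FG' Gb'].
    have [GG'|G'G] := FFtot _ _ FG FG'.
      by have [_ /(_ a) + _] := FFP _ FG'; apply; [exact: GG' Gb|].
    by have [_ /(_ a) + _] := FFP _ FG; apply; [exact: Gb|exact: G'G].
  - move=> a a' b [G FG Gb] [G' FG' Gb'].
    have [GG'|G'G] := FFtot _ _ FG FG'.
      by have [_ _ +] := FFP _ FG'; apply; [exact: GG' Gb|].
    by have [_ _ +] := FFP _ FG; apply; [exact: Gb|exact: G'G].
have [dH|/existsNP[a /not_implyP[Aa nHa]]] :=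
    pselect (forall a, A a -> exists b, H (a, b)).
  left; have /choice[g gP] : forall a, exists b, A a -> H (a, b).
    by move=> a; have [/dH[b]|nAa] := pselect (A a); [exists b|exists a].
  exists g; first by move=> a /gP/HAB[].
  move=> a a' /set_mem Aa /set_mem Aa' ga.
  by apply: (Hi _ _ _ (gP _ Aa)); rewrite ga; exact: gP.
have [rH|/existsNP[b /not_implyP[Bb nHb]]] :=
    pselect (forall b, B b -> exists a, H (a, b)).
  right; have /choice[g gP] : forall b, exists a, B b -> H (a, b).
    by move=> b; have [/rH[c]|nBb] := pselect (B b); [exists c|exists b].
  exists g; first by move=> c /gP/HAB[].
  move=> c c' /set_mem Bc /set_mem Bc' gc.
  by apply: (Hf _ _ _ (gP _ Bc)); rewrite gc; exact: gP.
exfalso; apply: (maxH (H `|` [set (a, b)])).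
  split; first by left.
  by move=> /(_ (a, b) (or_intror erefl)) Hab; apply: nHa; exists b.
split.
- by move=> a' b' [/HAB//|[-> ->]].
- move=> a' c c' [Hc|[ea ec]] [Hc'|[ea' ec']].
  + exact: Hf _ _ _ Hc Hc'.
  + by case: nHa; exists c; rewrite -ea'.
  + by case: nHa; exists c'; rewrite -ea.
  + by rewrite ec ec'.
- move=> c c' b' [Hc|[ec eb]] [Hc'|[ec' eb']].
  + exact: Hi _ _ _ Hc Hc'.
  + by case: nHb; exists c; rewrite -eb'.
  + by case: nHb; exists c'; rewrite -eb.
  + by rewrite ec ec'.
Qed.

Definition embeds (A B : Type) := exists f : A -> B, injective f.

Section square.
Context {I : Type}.
Implicit Types (G : set (I * I * I)).

Let dom G : set I := [set a | exists c, G (a, a, c)].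

(* Graphs of injections A * A -> A, with A recovered as the set of diagonal arguments. *)
Let square_graph G := [/\ forall u c c', G (u, c) -> G (u, c') -> c = c',
  forall u u' c, G (u, c) -> G (u', c) -> u = u',
  forall a b c, G (a, b, c) -> [/\ dom G a, dom G b & dom G c] &
  forall a b, dom G a -> dom G b -> exists c, G (a, b, c)].

Let square_graph_bigcup (C : set (set (I * I * I))) : C `<=` square_graph ->
  total_on C subset -> square_graph (\bigcup_(G in C) G).
Proof.
move=> CP Ctot.
have dir G G' : C G -> C G' -> exists G'', [/\ C G'', G `<=` G'' & G' `<=` G''].
  by move=> CG CG'; have [s|s] := Ctot _ _ CG CG'; [exists G'|exists G]; split.
split.
- move=> u c c' [G CG Gc] [G' CG' Gc'].
  have [G'' [CG'' s s']] := dir _ _ CG CG'; have [f _ _ _] := CP _ CG''.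
  exact: f _ _ _ (s _ Gc) (s' _ Gc').
- move=> u u' c [G CG Gc] [G' CG' Gc'].
  have [G'' [CG'' s s']] := dir _ _ CG CG'; have [_ f _ _] := CP _ CG''.
  exact: f _ _ _ (s _ Gc) (s' _ Gc').
- move=> a b c [G CG Gabc]; have [_ _ /(_ _ _ _ Gabc) + _] := CP _ CG.
  by move=> [[x ?] [y ?] [z ?]]; split; [exists x|exists y|exists z]; exists G.
- move=> a b [c [G CG Gc]] [c' [G' CG' Gc']].
  have [G'' [CG'' s s']] := dir _ _ CG CG'; have [_ _ _ f] := CP _ CG''.
  have [||d Gd] := f a b.
  - by exists c; exact: s.
  - by exists c'; exact: s'.
  - by exists d, G''.
Qed.

(** Take a maximal injection of a square [A * A] into [A]. If the complement of [A] embeds in [A],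
    so does [I], hence also [I * I]. Otherwise [A] has a disjoint copy [B], and the pairs over the
    union of [A] and [B] that are not in [A * A] can be sent injectively into [B], against
    maximality. *)
Lemma infinite_square : embeds nat I -> embeds (I * I) I.
Proof.
move=> [f injf].
pose G0 : set (I * I * I) :=
  [set u | exists m n, u = (f m, f n, f (pickle (m, n)))].
have domG0 n : dom G0 (f n) by exists (f (pickle (n, n))), n, n.
have PG0 : square_graph G0.
  split.
  - by move=> u c c' [m [n [-> ->]]] [m' [n' [/injf -> /injf -> ->]]].
  - move=> u u' c [m [n [-> ->]]] [m' [n' [->]]].
    by move=> /injf/(pcan_inj pickleK)[-> ->].
  - by move=> a b c [m [n [-> -> ->]]].
  - move=> a b [c [m [_ [-> _ _]]]] [d [n [_ [-> _ _]]]].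
    by exists (f (pickle (m, n))), m, n.
pose P G := square_graph G /\ (G = set0 \/ G0 `<=` G).
have [C CP Ctot|G [[PG G0G] maxG]] := @Zorn_bigcup _ P.
  split; first by apply: square_graph_bigcup => // G /CP[].
  have [[G [CG G0G]]|nC] := pselect (exists G, C G /\ G0 `<=` G).
    by right=> u G0u; exists G => //; exact: G0G.
  left; rewrite -subset0 => u [G CG Gu].
  have [_ [G0'|G0G]] := CP _ CG; first by rewrite G0' in Gu.
  by apply: nC; exists G.
have {}G0G : G0 `<=` G.
  case: G0G => // G_0; exfalso; apply: (maxG G0); last by split=> //; right.
  split; first by rewrite G_0.
  rewrite G_0 => /(_ (f 0, f 0, f (pickle (0, 0)))%N); apply.
  by exists 0%N, 0%N.
pose A := dom G; have [Gf Gi Gdom Gtot] := PG.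
have Af n : A (f n) by exists (f (pickle (n, n))); apply: G0G; exists n, n.
have /choice[q qP] : forall u : I * I, exists c, A u.1 -> A u.2 -> G (u, c).
  move=> [a b]; have [[Aa Ab]|nA] := pselect (A a /\ A b).
    by have [c ?] := Gtot _ _ Aa Ab; exists c.
  by exists a => Aa Ab; case: nA.
have qA a b : A a -> A b -> A (q (a, b)).
  by move=> Aa Ab; have [] := Gdom a b _ (qP (a, b) Aa Ab).
have qinj a b a' b' : A a -> A b -> A a' -> A b' ->
    q (a, b) = q (a', b') -> a = a' /\ b = b'.
  move=> Aa Ab Aa' Ab' qE; have := qP (a, b) Aa Ab; rewrite qE.
  by move=> /Gi/(_ (qP (a', b') Aa' Ab'))[].
have f01 : f 0%N <> f 1%N by move=> /injf.
(* A + B injects in A as soon as B does, the two tags being [f 0] and [f 1]. *)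
have tag (B : set I) (g : I -> I) : set_fun B A g -> set_inj B g ->
    exists2 h : I -> I, forall x, A x \/ B x -> A (h x) &
      forall x y, A x \/ B x -> A y \/ B y -> h x = h y -> x = y.
  move=> gA ginj.
  exists (fun x => if pselect (A x) then q (f 0, x)%N else q (f 1, g x)%N).
    move=> x ABx; case: pselect => [Ax|nAx]; apply: qA => //.
    by apply: gA; case: ABx.
  move=> x y ABx ABy; case: pselect => Ax; case: pselect => Ay.
  - by move=> /qinj[].
  - by case: ABy => // By /qinj[]//; exact: gA.
  - by case: ABx => // Bx /qinj[]//; [exact: gA|move=> /esym].
  - case: ABy => // By; case: ABx => // Bx /qinj[]//; try exact: gA.
    by move=> _; apply: ginj; exact: mem_set.
have full (h : I -> I) : (forall x, A (h x)) -> injective h -> embeds (I * I) I.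
  move=> hA hinj; exists (fun u => q (h u.1, h u.2)).
  by move=> [a b] [a' b'] /= /qinj[]// /hinj -> /hinj ->.
have [[b0 nAb0]|Afull] := pselect (exists b, ~ A b); last first.
  apply: (full id) => // x; apply: contrapT => nAx; apply: Afull.
  by exists x.
have [[g gA ginj]|[k kB kinj]] :=
    @embedding_total I (~` A) A _ _ nAb0 (Af 0%N).
  have [h hA hinj] := tag _ _ gA ginj.
  by apply: (full h) => [x|x y]; [apply: hA|apply: hinj]; exact: EM.
pose B := k @` A.
have /choice[g gP] : forall b, exists a, B b -> A a /\ k a = b.
  move=> b; have [[a Aa kab]|nBb] := pselect (B b); first by exists a.
  by exists b.
(* [g] inverts [k] on [B], so [tag] injects the union of [A] and [B] into [A]. *)
have [||h hA hinj] := tag B g.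
- by move=> b /gP[].
- move=> b b' /set_mem/gP[_ kb] /set_mem/gP[_ kb'] gE.
  by rewrite -kb -kb' gE.
have BA b : B b -> ~ A b by move=> [a Aa <-]; exact: kB.
pose D := A `|` B.
(* The new pairs are moved into [A] by [h], paired there by [q] and copied into [B] by [k]; the
   values of [G] stay in [A], so none collide. *)
pose N : set (I * I * I) := [set u | [/\ D u.1.1, D u.1.2,
  ~ (A u.1.1 /\ A u.1.2) & u.2 = k (q (h u.1.1, h u.1.2))]].
have kB' a : A a -> B (k a) by exists a.
have NB a b c : N (a, b, c) -> B c.
  by move=> [/= Da Db _ ->]; apply: kB'; apply: qA; exact: hA.
have GA a b c : G (a, b, c) -> [/\ A a, A b & A c] by exact: Gdom.
have domGN a : dom (G `|` N) a <-> D a.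
  split=> [[c [/GA[? _ _]|[]//]]|]; first by left.
  move=> Da; have [Aa|nAa] := pselect (A a).
    by have [c Gc] := Aa; exists c; left.
  by exists (k (q (h a, h a))); right; split=> //= -[].
exfalso; apply: (maxG (G `|` N)).
  split; first by left.
  move=> NG; apply: (BA (k (f 0%N))); first exact: kB'.
  have /domGN[c GNc] : D (k (f 0%N)) by right; exact: kB'.
  suff /GA[] : G (k (f 0%N), k (f 0%N), c) by [].
  by case: GNc => // Nc; apply: NG; right.
split; last by right=> u G0u; left; exact: G0G.
split.
- move=> [a b] c c' [Gc|Nc] [Gc'|Nc'].
  + exact: Gf _ _ _ Gc Gc'.
  + by case: Nc' => /= _ _ nAab _; case: nAab; have [] := GA _ _ _ Gc.
  + by case: Nc => /= _ _ nAab _; case: nAab; have [] := GA _ _ _ Gc'.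
  + by case: Nc => _ _ _ /= ->; case: Nc' => _ _ _ /= ->.
- move=> [a b] [a' b'] c [Gc|Nc] [Gc'|Nc'].
  + exact: Gi _ _ _ Gc Gc'.
  + by have /BA := NB _ _ _ Nc'; have [] := GA _ _ _ Gc.
  + by have /BA := NB _ _ _ Nc; have [] := GA _ _ _ Gc'.
  + case: Nc => /= Da Db _ cE; case: Nc' => /= Da' Db' _; rewrite cE => kq.
    have /qinj : q (h a, h b) = q (h a', h b').
      by apply: kinj kq; apply: mem_set; apply: qA; exact: hA.
    by case; try exact: hA; move=> /hinj-> // /hinj->.
- move=> a b c [/GA[Aa Ab Ac]|Nc].
    by split; apply/domGN; left.
  have := NB _ _ _ Nc; case: Nc => /= Da Db _ _ Bc.
  by split; apply/domGN => //; right.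
- move=> a b /domGN Da /domGN Db.
  have [[Aa Ab]|nAab] := pselect (A a /\ A b).
    by have [c Gc] := Gtot _ _ Aa Ab; exists c; left.
  by exists (k (q (h a, h b))); right; split.
Qed.

End square.

Lemma embeds_trans {A B C : Type} : embeds A B -> embeds B C -> embeds A C.
Proof. by move=> [f fi] [g gi]; exists (g \o f); exact: inj_comp. Qed.

Lemma embeds_prod {A B C D : Type} :
  embeds A C -> embeds B D -> embeds (A * B) (C * D).
Proof.
move=> [f fi] [g gi]; exists (fun u => (f u.1, g u.2)).
by move=> [a b] [a' b'] /= [/fi -> /gi ->].
Qed.

Lemma embeds_seq {A B : Type} : embeds A B -> embeds (seq A) (seq B).
Proof. by move=> [f fi]; exists (map f); exact: inj_map. Qed.

(** Iterated pairing is injective on sequences of a given length; the length is therefore encoded as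
    well. *)
Lemma infinite_seq {I : Type} : embeds nat I -> embeds (seq I) I.
Proof.
move=> [f fi]; have [p pi] := infinite_square (ex_intro _ f fi).
pose enc := foldr (fun x c => p (x, c)) (f 0%N).
have enci (s t : seq I) : size s = size t -> enc s = enc t -> s = t.
  elim: s t => [|x s IHs] [|y t] //= [st] /pi [-> /IHs->] //.
exists (fun s => p (f (size s), enc s)) => s t /pi[/fi].
exact: enci.
Qed.

(** * Sieves indexed by finite sequences *)

(* Nodes are lists with the latest choice at the head. *)
Fixpoint branch {J : Type} (b : nat -> J) (n : nat) : seq J :=
  if n is n'.+1 then b n' :: branch b n' else [::].

(** A complete sieve whose level [n] consists of the lists of length [n] and whose maps drop the
    head, so that its threads are the sequences [b]. *)
Definition tree_sieve {X : topologicalType} {J : Type} (O : seq J -> set X) :=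
  [/\ forall t, open (O t), O [::] = setT,
      forall t, O t = \bigcup_j O (j :: t) &
      forall b, complete_seq (fun n => O (branch b n))].

Lemma tree_sieve_child {X : topologicalType} {J : Type} (O : seq J -> set X)
  (j : J) (t : seq J) : tree_sieve O -> O (j :: t) `<=` O t.
Proof. by move=> [_ _ OE _] x Ox; rewrite OE; exists j. Qed.

Lemma tree_sieve_branch {X : topologicalType} {J : Type} (O : seq J -> set X)
    (b : nat -> J) (m n : nat) : tree_sieve O -> (m <= n)%N ->
  O (branch b n) `<=` O (branch b m).
Proof.
move=> tO; elim: n => [|n IHn]; first by rewrite leqn0 => /eqP->.
rewrite leq_eqVlt => /predU1P[->//|/IHn]; apply: subset_trans.
exact: tree_sieve_child.
Qed.

(** All levels are merged into one type, with an added root for the whole space, and the maps become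
    the relation [par]; indices no longer depend on the level. *)
Lemma sieve_complete_rel {X : topologicalType} : sieve_complete X ->
  exists (J : Type) (r : J) (par : J -> J -> Prop) (V : J -> set X),
    [/\ forall j, open (V j), V r = setT,
        forall j, V j `<=` \bigcup_(k in par j) V k &
        forall b : nat -> J, b 0%N = r -> (forall n, par (b n) (b n.+1)) ->
          complete_seq (V \o b)].
Proof.
move=> [Idx [U [pi [[oU [covU UE]] cU]]]].
exists (option {n & Idx n}), None,
  (fun o k => match o with
   | None => exists a, k = Some (existT _ 0%N a)
   | Some j => exists n a, j = existT _ n (pi n a) /\ k = Some (existT _ n.+1 a)
   end),
  (fun o => if o is Some (existT n a) then U n a else setT).
split=> //.
- by move=> [[n a]|]; [exact: oU|exact: openT].
- move=> [[n a]|] x.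
    by rewrite UE => -[b /= <- Ux]; exists (Some (existT _ n.+1 b)) => //; exists n, b.
  move=> _; have : setT x by [].
  by rewrite -(covU 0%N) => -[a _ Ux]; exists (Some (existT _ 0%N a)) => //; exists a.
move=> b b0 bpar G PG GV.
(* The added root shifts the levels by one. *)
have ex n : exists a, b n.+1 = Some (existT _ n a).
  elim: n => [|n [a ba]]; first by have := bpar 0%N; rewrite b0.
  have := bpar n.+1; rewrite ba => -[m [c [/(congr1 (@projT1 _ _))/= nm ->]]].
  by rewrite nm; exists c.
pose alpha n := sval (cid (ex n)).
have alphaE n : b n.+1 = Some (existT _ n (alpha n)) := svalP (cid (ex n)).
have alphapi n : pi n (alpha n.+1) = alpha n.
  have := bpar n.+1; rewrite !alphaE => -[m [c [an /Some_inj an1]]].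
  have /= nm := congr1 (@projT1 _ _) an; subst m.
  have -> := inj_pair2_eq_dec _ Nat.eq_dec _ _ _ _ an.
  by rewrite (inj_pair2_eq_dec _ Nat.eq_dec _ _ _ _ an1).
have GU n : G (U n (alpha n)) by have := GV n.+1; rewrite /= alphaE.
have [||x Gx] := cU alpha alphapi G; last by exists x; rewrite clusterE.
- split; first by exists setT; exact: (filterT : G setT).
  by move=> B1 B2 GB1 GB2; exists (B1 `&` B2) => //; exact: filterI.
- by move=> B n GB; exact: filter_ex (filterI GB (GU n)).
Qed.

Lemma lindelof_closed {X : topologicalType} {I : Type} (A : set X)
    (C : set (set X)) : lindelof_le X I -> closed A ->
  (forall c, C c -> open c) -> A `<=` \bigcup_(c in C) c ->
  exists q : I -> set X, (forall i, q i = set0 \/ C (q i)) /\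
    A `<=` \bigcup_i q i.
Proof.
move=> lX clA oC AC; have [||D [DC covD] /ocard_geP[g]] := lX (C `|` [set ~` A]).
- by move=> c [/oC//|->]; exact: closed_openC.
- rewrite -subTset => x _; have [Ax|nAx] := pselect (A x).
    by have [c Cc cx] := AC x Ax; exists c => //; left.
  by exists (~` A) => //; right.
exists (fun i => if g i is Some c then if pselect (C c) then c else set0 else set0).
split=> [i|x Ax].
  by case: (g i) => [c|]; [case: pselect => ?; [right|left]|left].
have : setT x by []; rewrite -covD => -[d Dd dx].
have Cd : C d by have [//|dA] := DC d Dd; rewrite dA in dx.
have [i _ gi] : range g (Some d) by apply: surj; exists d.
by exists i => //=; rewrite gi; case: pselect.
Qed.

(** A node carries an open set and an index of the given sieve whose member contains its closure.
    This closure is covered by open sets whose closures lie in members at child indices, and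
    [lindelof_closed] selects a family indexed by [I]. *)
Lemma sieve_complete_tree {X : topologicalType} {I : Type} :
  regular_space X -> sieve_complete X -> lindelof_le X I ->
  exists O : seq I -> set X, tree_sieve O.
Proof.
move=> regX /sieve_complete_rel[J [r [par [V [oV Vr Vcov cV]]]]] lX.
pose valid (u : set X * J) := open u.1 /\ closure u.1 `<=` V u.2.
have /choice[next nextP] : forall u : set X * J, exists q : I -> set X * J,
    valid u -> closure u.1 `<=` \bigcup_i (q i).1 /\
    forall i, valid (q i) /\ ((q i).1 = set0 \/ par u.2 (q i).2).
  move=> u; have [[/= oP PV]|nvu] := pselect (valid u); last by exists (fun=> u).
  have [|||q [qC qcov]] := @lindelof_closed X I (closure u.1)
      [set Q | open Q /\ exists2 k, par u.2 k & closure Q `<=` V k] lX.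
  - exact: closed_closure.
  - by move=> Q [].
  - move=> x /PV/Vcov[k jk Vkx].
    have [N nN NV] := regX x _ (open_nbhs_nbhs (conj (oV k) Vkx)).
    exists N°; last exact: nN.
    split; first exact: open_interior.
    by exists k => //; apply: subset_trans NV; apply: closureS; exact: interior_subset.
  (* An empty [q i] has no child index to go with it and receives the root [r]. *)
  have /choice[f fP] : forall i, exists v : set X * J,
      v.1 = q i /\ valid v /\ (v.1 = set0 \/ par u.2 v.2).
    move=> i; have [q0|[oQ [k jk Qk]]] := qC i; last first.
      by exists (q i, k); do !split=> //; right.
    exists (set0, r) => /=; rewrite q0; split=> //; split; last by left.
    by split=> /=; [exact: open0|rewrite closure0].
  exists f => _; split=> [x /qcov[i _ qx]|i]; last by have [] := fP i.
  by exists i => //; have [->] := fP i.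
pose st := foldr (fun i u => next u i) (setT, r).
have st_valid t : valid (st t).
  elim: t => [|i t IHt] /=; last by have [_ /(_ i)[]] := nextP _ IHt.
  by split=> /=; [exact: openT|rewrite Vr].
(* The sets chosen to cover [closure u.1] may stick out of [u.1]; intersecting along the list makes
   children lie in their parent. *)
pose O := fix O t := if t is i :: t' then O t' `&` (st t).1 else setT.
have Ost t : O t `<=` (st t).1 by case: t => [|i t] //= x [].
exists O; split=> //.
- by elim=> [|i t IHt]; [exact: openT|apply: openI => //; have [] := st_valid (i :: t)].
- move=> t; apply/seteqP; split=> [x Otx|x [i _ []]//].
  have [cov _] := nextP _ (st_valid t).
  have [i _ xi] := cov x (subset_closure (Ost _ _ Otx)).
  by exists i.
move=> b G PG GO.
have Gst n : G (st (branch b n)).1 by apply: filterS (GO n); exact: Ost.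
apply: (cV (fun n => (st (branch b n)).2)) => //.
  (* A proper filter excludes the empty filler nodes, so the indices do follow [par]. *)
  move=> n; have [_ /(_ (b n))[_ []//]] := nextP _ (st_valid (branch b n)).
  by move=> s0; have := Gst n.+1; rewrite /= s0 => /filter_not_empty.
move=> n; apply: filterS (Gst n) => x /subset_closure.
by have [_] := st_valid (branch b n); apply.
Qed.

Lemma tree_sieve_complete {Y : topologicalType} {J : Type} (V : seq J -> set Y) :
  tree_sieve V -> sieve_complete Y.
Proof.
move=> tV; have [oV V0 VE cV] := tV.
exists (fun n => n.-tuple J), (fun n (t : n.-tuple J) => V t), (fun n (t : n.+1.-tuple J) => behead_tuple t).
split.
  split; first by move=> n a; exact: oV.
  have VE' n (a : n.-tuple J) : V a =
      \bigcup_(c in [set c : n.+1.-tuple J | behead_tuple c = a]) V c.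
    rewrite VE; apply/seteqP; split=> x.
      by move=> [j _ Vx]; exists [tuple of j :: a] => //=; exact/val_inj.
    move=> [c /= <-] Vx; exists (thead c) => //.
    by rewrite [c]tuple_eta in Vx.
  split=> // n; rewrite -subTset; elim: n => [|n IHn] x _.
    by exists [tuple] => //=; rewrite V0.
  have [a _] := IHn x I; rewrite VE' => -[c _ Vx].
  by exists c.
move=> alpha alphapi B [[B0 BB0] BI] Bmeet.
have alphaE n : tval (alpha n) = branch (fun n => thead (alpha n.+1)) n.
  elim: n => [|n IHn]; first by rewrite [alpha 0%N]tuple0.
  by rewrite /= -IHn -(alphapi n); case/tupleP: (alpha n.+1) => j t.
have dec m n : (m <= n)%N -> V (alpha n) `<=` V (alpha m).
  by move=> mn; rewrite !alphaE; exact: tree_sieve_branch.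
(* The filter generated by [B] and the thread; meshing makes it proper. *)
pose G := filter_from [set Bn : set Y * nat | B Bn.1]
            (fun Bn => Bn.1 `&` V (alpha Bn.2)).
have PG : ProperFilter G.
  apply: filter_from_proper; last by move=> [C n] /= BC; exact: Bmeet.
  apply: filter_from_filter; first by exists (B0, 0%N).
  move=> [B1 n1] [B2 n2] /= BB1 BB2; have [B3 BB3 sB3] := BI _ _ BB1 BB2.
  exists (B3, maxn n1 n2) => // x [/= /sB3[B1x B2x] Vx]; split; split=> //.
    by apply: dec Vx; exact: leq_maxl.
  by apply: dec Vx; exact: leq_maxr.
have [|x Gx] := cV (fun n => thead (alpha n.+1)) G PG.
  by move=> n; rewrite -alphaE; exists (B0, n) => // x [].
exists x => C BC N nN; apply: Gx nN.
by exists (C, 0%N) => // y [].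
Qed.

Lemma card_le_embeds {A B : Type} : embeds A B -> ([set: A] #<= [set: B])%card.
Proof.
move=> [f fi]; apply: card_le_trans (card_leT (f @` setT)).
have /inj_card_eq : {in [set: A] &, injective f} by move=> x y _ _ /fi.
by rewrite card_eq_le => /andP[].
Qed.

(** Each node covered by finitely many members of [C] contributes such a finite family [d t]. Every
    point [y] lies in such a node: otherwise, along a path of nodes through [y], removing finite
    unions of members of [C] leaves a proper filter, and its cluster point could belong to no member
    of [C]. The subcover is enumerated by a node and a position in its list. *)
Lemma tree_sieve_lindelof {Y : topologicalType} {J I : Type}
    (V : seq J -> set Y) : tree_sieve V ->
  embeds (seq J * nat) I -> lindelof_le Y I.
Proof.
move=> tV eJ C oC covC; have [oV V0 VE cV] := tV.
pose finc t (d : seq (set Y)) :=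
  [set` d] `<=` C /\ V t `<=` \bigcup_(c in [set` d]) c.
have /choice[d dP] : forall t, exists d : seq (set Y),
    [set` d] `<=` C /\ ((exists d', finc t d') -> finc t d).
  move=> t; have [[d fd]|nd] := pselect (exists d, finc t d).
    by exists d; split=> //; have [] := fd.
  by exists [::]; split=> // c; rewrite /= in_nil.
exists [set c | exists t, c \in d t].
  split; first by move=> c [t]; have [+ _] := dP t; apply.
  rewrite -subTset => y _.
  have /choice[nx nxP] : forall t, exists j, V t y -> V (j :: t) y.
    move=> t; have [|nVt] := pselect (V t y).
      by rewrite VE => -[j _ Vj]; exists j.
    have : V [::] y by rewrite V0.
    by rewrite VE => -[j _ _]; exists j.
  pose path := fix path n := if n is n'.+1 then nx (path n') :: path n' else [::].
  have pathE n : path n = branch (nx \o path) n by elim: n => //= n ->.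
  have Vy n : V (path n) y.
    by elim: n => [|n IHn] /=; [rewrite V0|exact: nxP].
  have dec m n : (m <= n)%N -> V (path n) `<=` V (path m).
    by move=> mn; rewrite !pathE; exact: tree_sieve_branch.
  have [[n [d' fd']]|nfin] := pselect (exists n, exists d', finc (path n) d').
    have [_ /(_ (ex_intro _ d' fd'))[_ dV]] := dP (path n).
    by have [c dc cy] := dV y (Vy n); exists c => //; exists (path n).
  exfalso.
  pose G := filter_from [set nd : nat * seq (set Y) | [set` nd.2] `<=` C]
    (fun nd => V (path nd.1) `\` \bigcup_(c in [set` nd.2]) c).
  have PG : ProperFilter G.
    apply: filter_from_proper; last first.
      move=> [n d'] /= d'C; apply/set0P/negP => /eqP; rewrite setD_eq0 => Vd'.
      by apply: nfin; exists n, d'.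
    apply: filter_from_filter; first by exists (0%N, [::]) => c; rewrite /= in_nil.
    move=> [n1 d1] [n2 d2] /= d1C d2C; exists (maxn n1 n2, d1 ++ d2).
      by move=> c; rewrite /= mem_cat => /orP[/d1C|/d2C].
    move=> x [Vx nx12]; split; split=> /=.
    - by apply: dec Vx; exact: leq_maxl.
    - by move=> [c cd cx]; apply: nx12; exists c => //; rewrite /= mem_cat [_ \in _]cd.
    - by apply: dec Vx; exact: leq_maxr.
    - by move=> [c cd cx]; apply: nx12; exists c => //; rewrite /= mem_cat orbC [_ \in _]cd.
  have [n|p Gp] := cV (nx \o path) G PG.
    rewrite -pathE; exists (n, [::]) => [c|x []//].
    by rewrite /= in_nil.
  have : setT p by []; rewrite -covC => -[c Cc cp].
  have Gc : G (V (path 0%N) `\` c).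
    exists (0%N, [:: c]) => [c'|x [Vx nx']]; first by rewrite /= inE => /eqP->.
    by split=> // cx; apply: nx'; exists c => //=; rewrite inE.
  by have [x [[_ ncx] cx]] := Gp _ _ Gc (open_nbhs_nbhs (conj (oC c Cc) cp)).
apply: card_le_trans (card_le_embeds eJ).
apply: card_le_trans (card_image_le
  (fun u : seq J * nat => nth set0 (d u.1) u.2) setT).
by apply: subset_card_le => c [t /(nthP set0)[k _ ck]]; exists (t, k).
Qed.

(** * The sieve induced by a set tri-quotient map *)

Lemma ultra_bigcup {X : Type} {T : eqType} (G : set_system X) (A : T -> set X)
    (s : seq T) : UltraFilter G -> G (\bigcup_(t in [set` s]) A t) ->
  exists2 t, t \in s & G (A t).
Proof.
move=> UG; elim: s => [|a s IHs] Gs.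
  by have [x [t]] := filter_ex Gs; rewrite /= in_nil.
have [Ga|Gna] := in_ultra_setVsetC (A a) UG; first by exists a; rewrite ?mem_head.
have [|t ts Gt] := IHs; last by exists t => //; rewrite inE ts orbT.
apply: filterS (filterI Gs Gna) => x [[t /=]].
by rewrite inE => /predU1P[->//|ts] Ax _; exists t.
Qed.

Definition extends {I : choiceType} (E' E : seq (seq I)) :=
  all (fun t => if t is _ :: t' then t' \in E else false) E'.

Definition nodes_union {X : topologicalType} {I : choiceType}
  (O : seq I -> set X) (E : seq (seq I)) := \bigcup_(t in [set` E]) O t.

Lemma nodes_union_sub {X : topologicalType} {I : choiceType}
    (O : seq I -> set X) (E E' : seq (seq I)) :
  tree_sieve O -> extends E' E -> nodes_union O E' `<=` nodes_union O E.
Proof.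
move=> tO /allP E'E x [[|i t] /= /E'E //= tE Ox].
by exists t => //; exact: tree_sieve_child Ox.
Qed.

(* Koenig's lemma: the nodes met by an ultrafilter form an infinite finitely
   branching tree; a branch is selected with an ultrafilter on the levels. *)
Lemma complete_seq_nodes_union {X : topologicalType} {I : choiceType}
    (O : seq I -> set X) (E : nat -> seq (seq I)) :
  tree_sieve O -> E 0%N = [:: [::]] -> (forall n, extends (E n.+1) (E n)) ->
  complete_seq (fun n => nodes_union O (E n)).
Proof.
move=> tO E0 EE; apply: complete_seq_ultra => G UG GE.
have /choice[t tP] : forall n, exists t, t \in E n /\ G (O t).
  by move=> n; have [t tE Gt] := ultra_bigcup _ _ _ UG (GE n); exists t.
have dropE m k u : u \in E (k + m)%N -> drop m u \in E k.
  elim: m u => [|m IHm] u; first by rewrite addn0 drop0.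
  rewrite addnS => uE; have /allP/(_ u uE) := EE (k + m)%N.
  by case: u {uE} => // i u; exact: IHm.
have dropO m u : O u `<=` O (drop m u).
  elim: m u => [|m IHm] u; first by rewrite drop0.
  case: u => // i u /=; apply: subset_trans (IHm u).
  exact: tree_sieve_child.
have [U [UU ooU]] := ultraFilterLemma (eventually_filter).
(* [a k] is the ancestor at level [k] of [t n] for [U]-almost all [n]. Comparing levels [k] and
   [k.+1] at a common [n] shows that these ancestors form a branch. *)
have /choice[a aP] : forall k, exists a, a \in E k /\
    U [set n | (k <= n)%N /\ drop (n - k) (t n) = a].
  move=> k; suff /(ultra_bigcup _ _ _ UU)[a] : U (\bigcup_(a in [set` E k])
      [set n | (k <= n)%N /\ drop (n - k) (t n) = a]) by exists a.
  apply: ooU; exists k => // n /= kn; exists (drop (n - k) (t n)) => //=.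
  by apply: dropE; rewrite subnKC//; have [] := tP n.
have /choice[b bP] : forall k, exists i, a k.+1 = i :: a k.
  move=> k; have [_ Uk] := aP k; have [ak1 Uk1] := aP k.+1.
  have [n [[kn <-] [k1n]]] := filter_ex (filterI Uk Uk1).
  have -> : (n - k = (n - k.+1).+1)%N by rewrite -subSn// subSS.
  have /allP/(_ _ ak1) := EE k; case: (a k.+1) => // i u _ tnE.
  by exists i; rewrite -[(n - k.+1).+1]add1n -drop_drop tnE /= drop0.
have abranch k : a k = branch b k.
  elim: k => [|k IHk]; last by rewrite bP IHk.
  by have [] := aP 0%N; rewrite E0 inE => /eqP.
have [_ _ _ cO] := tO; apply: (cO b) => k; rewrite -abranch.
have [_ /filter_ex[n [_ <-]]] := aP k.
by have [_] := tP n; apply: filterS; exact: dropO.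
Qed.

(** If [f] is unbounded there, the open set where its absolute value exceeds [n] meets [V n] in some
    [y n]; but [f] is bounded on a compact set containing all [y n]. *)
Lemma fbounded_bigcap_closure {R : realType} {Y : topologicalType}
    (V : nat -> set Y) :
  (forall y : nat -> Y, (forall n, V n (y n)) ->
     exists2 C : set Y, compact C & forall n, C (y n)) ->
  fbounded R (\bigcap_n closure (V n)).
Proof.
move=> cV f cf; apply: contrapT => fub.
have /choice[y yP] : forall n, exists y, V n y /\ (n%:R < `|f y|)%R.
  move=> n; have [z clz fz] :
      exists2 z, (\bigcap_n closure (V n)) z & (n%:R < `|f z|)%R.
    apply: contrapT => nz; apply: fub; exists (n%:R)%R => z clz.
    by rewrite leNgt; apply/negP => fz; apply: nz; exists z.
  have [y [Vy fy]] : V n `&` [set y | (n%:R < `|f y|)%R] !=set0.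
    apply: (clz n I); apply: open_nbhs_nbhs; split => //.
    have : continuous (fun y => `|f y|)%R.
      by move=> x; apply: continuous_comp; [exact: cf|exact: norm_continuous].
    by move=> /continuousP/(_ _ (@open_gt R (n%:R)%R)).
  by exists y.
have [C cC Cy] := cV y (fun n => (yP n).1).
have : compact (f @` C).
  by apply: continuous_compact => //; exact: continuous_subspaceT.
move=> /(@compact_bounded R R^o)[M [_ /(_ (M + 1)%R)]].
rewrite ltrDl ltr01 => /(_ isT) fM.
pose n := (Num.truncn (M + 1)%R).+1.
have : (`|f (y n)| <= M + 1)%R by apply: fM; exists (y n).
by rewrite leNgt (lt_trans _ (yP n).2)// truncnS_gt.
Qed.

(** If the closures of the members of [G] all meet the compact intersection, their traces cluster
    there. If [closure B] misses it, points [y n] of [B] in [V n] have a cluster point lying in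
    both, a contradiction. *)
Lemma complete_seq_compact_bigcap {Y : topologicalType} (V : nat -> set Y) :
  (forall y : nat -> Y, (forall n, V n (y n)) ->
     exists2 C : set Y, compact C & forall n, C (y n)) ->
  (forall m n, (m <= n)%N -> V n `<=` V m) ->
  compact (\bigcap_n closure (V n)) -> complete_seq V.
Proof.
move=> cV decV cC G PG GV.
have [[B [GB Bdisj]]|nB] := pselect (exists B, G B /\
    closure B `&` \bigcap_n closure (V n) = set0); last first.
  pose H := filter_from G (fun B => closure B `&` \bigcap_n closure (V n)).
  have PH : ProperFilter H.
    apply: filter_from_proper; last first.
      by move=> B GB; apply/set0P/negP => /eqP B0; apply: nB; exists B.
    apply: filter_from_filter; first by exists setT; exact: (filterT : G setT).
    move=> B1 B2 GB1 GB2; exists (B1 `&` B2); first exact: filterI.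
    move=> x [clx Cx]; split; split=> //.
      by apply: closureS clx; exact: subIsetl.
    by apply: closureS clx; exact: subIsetr.
  have [|p [_ Hp]] := cC H PH; first by exists setT; [exact: filterT|move=> x []].
  exists p => B N GB nN; apply: (@closed_closure _ B p) nN => N' nN'.
  by apply: Hp nN'; exists B => // x [].
have /choice[y yP] : forall n, exists y, B y /\ V n y.
  by move=> n; have [y []] := filter_ex (filterI GB (GV n)); exists y.
have [C cptC Cy] := cV y (fun n => (yP n).2).
have [|p [_ Hp]] := cptC (y @ \oo) _; first by exists 0%N => // n _; exact: Cy.
suff : (closure B `&` \bigcap_n closure (V n)) p by rewrite Bdisj.
split=> [|n _] N nN; apply: Hp nN.
  by exists 0%N => // n _; have [] := yP n.
by exists n => // m /= nm; apply: (decV _ _ nm); have [] := yP m.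
Qed.

(** A node of the sieve on [Y] is a history, latest first, of finite sets of nodes of [O]. The
    default [[:: [::]]] is the initial set, formed by the root alone. *)
Fixpoint extending {I : choiceType} (u : seq (seq (seq I))) : bool :=
  if u is E :: v then extends E (head [:: [::]] v) && extending v else true.

Lemma tri_quotient_tree {R : realType} {X Y : topologicalType} {I : choiceType}
    (O : seq I -> set X) (F : set X -> set Y) :
  regular_space X -> mu_space R Y -> tree_sieve O ->
  monotone_on_compacts F -> set_tri_quotient F ->
  (forall K : set X, compact K -> compact (closure (F K))) ->
  exists V : seq (seq (seq I)) -> set Y, tree_sieve V.
Proof.
move=> regX muY tO Fmono [s [os [sF [sT [smono str4]]]]] Fcl.
have [oO O0 OE _] := tO.
have oU E : open (nodes_union O E) by apply: bigcup_open => t _; exact: oO.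
(* Ill-formed histories get the empty set, so every list can serve as an index. *)
pose V u := if extending u then s (nodes_union O (head [:: [::]] u)) else set0.
have VE u : V u = \bigcup_E V (E :: u).
  apply/seteqP; split=> y; last first.
    move=> [E _]; rewrite /V /=; case: ifP => // /andP[Eu ->].
    by apply: smono => //; exact: nodes_union_sub.
  rewrite /V; case: ifP => // extu; set E0 := head _ u => sy.
  (* The children of the nodes of [E0] cover their union, hence every compact subset of it; (str4)
     then keeps finitely many children, which form the next finite set. *)
  pose W : set (set X) :=
    [set w | exists i t, t \in E0 /\ w = O (i :: t)].
  have [||L [/finite_seqP[l ->] LW] sL] := str4 _ _ W (oU E0) sy.
  - by move=> w [i [t [_ ->]]]; exact: oO.
  - move=> x [K [_ [KU _]] /KU[t tE]]; rewrite OE => -[i _ Ox].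
    by exists (O (i :: t)) => //; exists i, t.
  have /choice[g gP] : forall w, exists t : seq I, W w ->
      w = O t /\ extends [:: t] E0.
    move=> w; have [[i [t [tE ->]]]|nW] := pselect (W w); last by exists [::].
    by exists (i :: t); rewrite /= tE.
  exists (map g l) => //=; rewrite extu andbT ifT.
    apply: smono sL => // [|x [w lw wx]].
      by apply: bigcup_open => w /LW[i [t [_ ->]]]; exact: oO.
    have [wE _] := gP w (LW w lw); exists (g w); last by rewrite -wE.
    exact: map_f.
  by apply/allP => _ /mapP[w lw ->]; have [_ /andP[]] := gP w (LW w lw).
have tV0 : V [::] = setT.
  rewrite -sT /V /=; congr s; rewrite -subTset => x _.
  by exists [::]; rewrite ?O0//= inE.
exists V; split=> //.
  by move=> u; rewrite /V; case: ifP => _; [exact: os|exact: open0].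
move=> e G PG GV.
(* Members of the proper filter [G] are nonempty, so every history on this branch is well formed. *)
have ext n : extending (branch e n).
  have [y] := filter_ex (GV n); rewrite /V; by case: ifP.
pose E n := head [:: [::]] (branch e n).
have EE n : extends (E n.+1) (E n) by have := ext n.+1 => /= /andP[].
pose U n := nodes_union O (E n).
have cU : complete_seq U by exact: complete_seq_nodes_union.
have Vs n : V (branch e n) = s (U n) by rewrite /V ext.
have decn T (A : nat -> set T) : (forall n, A n.+1 `<=` A n) ->
    forall m n, (m <= n)%N -> A n `<=` A m.
  move=> dA m; elim=> [|n IHn]; first by rewrite leqn0 => /eqP->.
  by rewrite leq_eqVlt => /predU1P[->//|/IHn]; apply: subset_trans.
have decU : forall m n, (m <= n)%N -> U n `<=` U m.
  by apply: decn => n; exact: nodes_union_sub.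
have decV : forall m n, (m <= n)%N -> V (branch e n) `<=` V (branch e m).
  by apply: decn => n /= x Vx; rewrite VE; exists (e n).
have seqV (y : nat -> Y) : (forall n, V (branch e n) (y n)) ->
    exists2 C : set Y, compact C & forall n, C (y n).
  move=> Vy; have /choice[K KP] : forall n, exists K,
      [/\ compact K, K `<=` U n & F K (y n)].
    by move=> n; have := Vy n; rewrite Vs => /(sF _ (oU _))[K [cK KU] FK]; exists K.
  have [|n|L cL KL] := compact_seq_union U K regX decU cU.
  - by move=> n; have [] := KP n.
  - by have [] := KP n.
  exists (closure (F L)); first exact: Fcl.
  move=> n; apply: subset_closure; have [cK _] := KP n.
  exact: Fmono.
apply: (complete_seq_compact_bigcap _ seqV decV) => //.
apply: muY; last exact: fbounded_bigcap_closure.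
by apply: closed_bigI => n _; exact: closed_closure.
Qed.

Theorem theorem3p3 (R : realType) (X Y : topologicalType)
  (tyX : tychonoff_space R X) (tyY : tychonoff_space R Y)
  (hX : sieve_complete X) (hY : mu_space R Y)
  (F : set X -> set Y)
  (Fmono : monotone_on_compacts F) (Fstq : set_tri_quotient F)
  (Fcl : forall K : set X, compact K -> compact (closure (F K))) :
  sieve_complete Y /\
  (forall I : Type, (exists f : nat -> I, injective f) ->
     lindelof_le X I -> lindelof_le Y I).
Proof.
have regX := tychonoff_regular tyX.
have tree (I : choiceType) : lindelof_le X I ->
    exists V : seq (seq (seq I)) -> set Y, tree_sieve V.
  move=> lX; have [Q tQ] := sieve_complete_tree regX hX lX.
  exact: (tri_quotient_tree Q F regX hY tQ).
split.
  (* Any cover is its own subcover of cardinality at most that of [set X], so this index type is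
     always available. *)
  have [|V tV] := tree (set X); last exact: tree_sieve_complete tV.
  by move=> C oC covC; exists C; [split|exact: card_leT].
move=> I infI lX; have [V tV] := tree {classic I} lX.
apply: (tree_sieve_lindelof _ tV).
have sI := infinite_seq infI.
(* The sieve on [Y] is indexed by lists of finite sets of lists over [I], whence three nested
   [seq]. *)
have sssI : embeds (seq (seq (seq I))) I.
  exact: embeds_trans (embeds_seq (embeds_trans (embeds_seq sI) sI)) sI.
apply: embeds_trans (embeds_prod sssI infI) (infinite_square infI).
Qed.
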